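(* For any quasi-symmetric function $f\in\mathrm{QSym}$, $$\Delta_\#\bigl(f(\mathbf X)\bigr)=f(\mathbf X+\mathbf Y+\mathbf X\mathbf Y).$$
   Context: Let $\Bbbk$ be a field of characteristic zero. An alphabet is a countable totally ordered set of variables; $\mathbf X=\{x_1<x_2<\cdots\}$ and $\mathbf Y=\{y_1<y_2<\cdots\}$ are alphabets. $\mathrm{QSym}=\mathrm{QSym}(\mathbf X)$ is the space of quasi-symmetric functions, with basis $M_\alpha=\sum_{i_1<\cdots<i_r}x_{i_1}^{a_1}\cdots x_{i_r}^{a_r}$, $\alpha=(a_1,\dots,a_r)$ running over all compositions. For an alphabet $\mathbf Z$, $M_\alpha(\mathbf Z)=\sum_{z_1<\cdots<z_r\in\mathbf Z}z_1^{a_1}\cdots z_r^{a_r}$, extended linearly to $f(\mathbf Z)$, $f\in\mathrm{QSym}$. The symbol $\mathbf X+\mathbf Y+\mathbf X\mathbf Y$ denotes the ordered alphabet $(\mathbf 1+\mathbf X)\times(\mathbf 1+\mathbf Y)-\mathbf 1$: here $\mathbf 1+\mathbf X$ is $\mathbf X$ with an additional variable $x_0$ smaller than all the others and with $x_0^k=x_0$ (it acts as the unit: $x_0=1$), similarly $\mathbf 1+\mathbf Y$ with $y_0$; the product is ordered by the reverse lexicographic order ($(x_h,y_i)<(x_j,y_k)$ iff $y_i<y_k$, or $y_i=y_k$ and $x_h<x_j$); the pair $(x_0,y_0)$ is removed; and the pair $(x_i,y_j)$ is evaluated as the monomial $x_iy_j$. Thus $(x_i,y_0)$ is evaluated as $x_i$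 and $(x_0,y_j)$ as $y_j$. Functions of $\mathbf X,\mathbf Y$ quasi-symmetric in each set are identified with $\mathrm{QSym}\otimes\mathrm{QSym}$ by separation of variables, $M_\alpha(\mathbf X)M_\beta(\mathbf Y)\leftrightarrow M_\alpha\otimes M_\beta$. $\Sigma=\bigoplus_n\Sigma_n$, $\Sigma_n\subseteq\Bbbk S_n$ with basis $X_\alpha=\sum_{\mathrm{Des}(\sigma)\subseteq\{a_1,a_1+a_2,\dots,a_1+\cdots+a_{r-1}\}}\sigma$ ($\alpha$ a composition of $n$, $\mathrm{Des}(\sigma)=\{i:\sigma(i)>\sigma(i+1)\}$). Its Heisenberg product is the restriction of that of permutations; explicitly, for compositions $\alpha=(a_1,\dots,a_r)$ of $p$, $\beta=(b_1,\dots,b_s)$ of $q$, $X_\alpha\#X_\beta=\sum_{n=\max(p,q)}^{p+q}\sum_{M\in\mathcal M^n_{\alpha,\beta}}X_{c(M)}$, where $\mathcal M^n_{\alpha,\beta}$ is the set of matrices $M=(m_{ij})_{0\le i\le s,\,0\le j\le r}$ of non-negative integers with $m_{00}=0$, column sums $(n-p,a_1,\dots,a_r)$ and row sums $(n-q,b_1,\dots,b_s)$, and $c(M)$ is the composition of non-zero entries read left to right, top to bottom. The pairing between $\mathrm{QSym}$ and $\Sigma$ is $\langle M_\alpha,X_\beta\rangle=\delta_{\alpha,\beta}$, with $\langle f\otimes g,u\otimes v\rangle=\langle f,u\rangle\langle g,v\rangle$. The Heisenberg coproduct $\Delta_\#:\mathrm{QSym}\to\mathrm{QSym}\otimes\mathrm{QSym}$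 is defined by $\langle\Delta_\#f,u\otimes v\rangle=\langle f,u\#v\rangle$ for all $u,v\in\Sigma$. *)

(* Defs.v *)
From HB Require Import structures.
From mathcomp Require Import all_boot all_order all_algebra all_fingroup finmap zify.
From mathcomp Require Import boolp classical_sets functions cardinality fsbigop.
From mathcomp.multinomials Require Import monalg.

Set Implicit Arguments.
Unset Strict Implicit.
Unset Printing Implicit Defensive.

Import GRing.Theory.
Local Open Scope classical_set_scope.
Local Open Scope ring_scope.

Section LinearCombinations.
Context {k : fieldType} {I : choiceType} {V : lmodType k}.
Implicit Types (e : I -> V) (c : {malg k[I]}) (v : V).

Definition lcomb e c : V := \sum_(i <- msupp c) c@_i *: e i.

Definition span e : set V := range (lcomb e).

Definition lin_indep e : Prop := injective (lcomb e).

(* Meaningful when e is linearly independent and v lies in its span. *)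
Definition coord e v : {malg k[I]} := xget 0 [set c | lcomb e c = v].

End LinearCombinations.

Definition composition := {a : seq nat | all (leq 1) a}.

Section MonomialPairs.
Context {M N : conomType}.
Implicit Types p q r : M * N.

Definition mpair_one : M * N := (mone, mone).
Definition mpair_mul p q : M * N := (mmul p.1 q.1, mmul p.2 q.2).

Lemma mpair_mulA : associative mpair_mul.
Proof. by move=> p q r; rewrite /mpair_mul /= !mulmA. Qed.
Lemma mpair_mul1m : left_id mpair_one mpair_mul.
Proof. by case=> u v; rewrite /mpair_mul /= !mul1m. Qed.
Lemma mpair_mulm1 : right_id mpair_one mpair_mul.
Proof. by case=> u v; rewrite /mpair_mul /= !mulm1. Qed.
Lemma mpair_unitm p q :
  mpair_mul p q = mpair_one -> p = mpair_one /\ q = mpair_one.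
Proof.
by case: p q => [u v] [u' v'] [] /unitm[/= -> ->] /unitm[/= -> ->].
Qed.
Lemma mpair_mulC : commutative mpair_mul.
Proof. by move=> p q; rewrite /mpair_mul !(mulmC p.1) !(mulmC p.2). Qed.

HB.instance Definition _ := Choice_isMonomialDef.Build (M * N)%type
  mpair_mulA mpair_mul1m mpair_mulm1 mpair_unitm.
HB.instance Definition _ :=
  MonomialDef_isConomialDef.Build (M * N)%type mpair_mulC.

End MonomialPairs.

Definition mexp (W : conomType) (m : W) (n : nat) : W := iterop n mmul m mone.

(* An ordered alphabet whose letters are evaluated as monomials of W. *)
Record alphabet (W : conomType) := Alphabet {
  letter :> countType;
  letter_lt : rel letter;
  letter_irr : irreflexive letter_lt;
  letter_trans : transitive letter_lt;
  letter_total : forall x y, x != y -> letter_lt x y || letter_lt y x;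
  letter_val : letter -> W }.

Section Alphabets.
Context {W : conomType}.
Implicit Types A B : alphabet W.

Lemma ltn_neq_total (i j : nat) : i != j -> (i < j)%N || (j < i)%N.
Proof. by rewrite neq_ltn. Qed.

Definition var_alphabet (h : nat -> W) : alphabet W :=
  @Alphabet W nat ltn ltnn ltn_trans ltn_neq_total h.

Definition opt_lt A : rel (option A) := fun x y =>
  match x, y with
  | None, Some _ => true
  | Some x', Some y' => letter_lt x' y'
  | _, None => false
  end.

Lemma opt_irr A : irreflexive (@opt_lt A).
Proof. by case=> //= x; rewrite letter_irr. Qed.
Lemma opt_trans A : transitive (@opt_lt A).
Proof. by case=> [x|] [y|] [z|] //=; apply: letter_trans. Qed.
Lemma opt_total A (x y : option A) : x != y -> opt_lt x y || opt_lt y x.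
Proof. by case: x y => [x|] [y|] //= xy; apply: letter_total. Qed.

Definition one_add A : alphabet W :=
  @Alphabet W (option A) _ (@opt_irr A) (@opt_trans A) (@opt_total A)
    (fun x => if x is Some x' then letter_val x' else mone).

Definition revlex_lt A B : rel (A * B) := fun p q =>
  letter_lt p.2 q.2 || (p.2 == q.2) && letter_lt p.1 q.1.

Lemma revlex_irr A B : irreflexive (@revlex_lt A B).
Proof. by move=> p; rewrite /revlex_lt !letter_irr andbF. Qed.
Lemma revlex_trans A B : transitive (@revlex_lt A B).
Proof.
case=> [x y] [x' y'] [x'' y'']; rewrite /revlex_lt /=.
case/orP=> [lt1|/andP[/eqP-> lt1]]; last first.
  case/orP=> [->//|/andP[/eqP-> lt2]].
  by rewrite eqxx (letter_trans lt1 lt2) orbT.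
case/orP=> [lt2|/andP[/eqP<- _]]; last by rewrite lt1.
by rewrite (letter_trans lt1 lt2).
Qed.
Lemma revlex_total A B (p q : A * B) : p != q -> revlex_lt p q || revlex_lt q p.
Proof.
case: p q => [x y] [x' y']; rewrite /revlex_lt /= xpair_eqE negb_and.
have [->|yy _] := eqVneq y y'; last first.
  by case/orP: (letter_total yy) => ->; rewrite ?orbT.
by rewrite !letter_irr orbF => /letter_total.
Qed.

Definition mul_alphabet A B : alphabet W :=
  @Alphabet W (A * B)%type _ (@revlex_irr A B) (@revlex_trans A B)
    (@revlex_total A B) (fun p => mmul (letter_val p.1) (letter_val p.2)).

Definition sub_letter_lt A (a : A) : rel {x : A | x != a} :=
  fun x y => letter_lt (val x) (val y).

Lemma sub_letter_irr A (a : A) : irreflexive (@sub_letter_lt A a).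
Proof. by move=> x; apply: letter_irr. Qed.
Lemma sub_letter_trans A (a : A) : transitive (@sub_letter_lt A a).
Proof. by move=> x y z; apply: letter_trans. Qed.
Lemma sub_letter_total A (a : A) (x y : {x : A | x != a}) :
  x != y -> sub_letter_lt x y || sub_letter_lt y x.
Proof. by move=> xy; apply: letter_total. Qed.

Definition sub_letter A (a : A) : alphabet W :=
  @Alphabet W {x : A | x != a} _ (@sub_letter_irr A a) (@sub_letter_trans A a)
    (@sub_letter_total A a) (fun x => letter_val (val x)).

Definition word_monomial A (z : seq A) (a : seq nat) : W :=
  \big[mmul/mone]_(p <- zip z a) mexp (letter_val p.1) p.2.

End Alphabets.

(* The index i stands for the variable of rank i + 1. *)
Definition xmonom : conomType := {cmonom nat}.
Definition alphX : alphabet xmonom := var_alphabet (fun i : nat => ucm i : xmonom).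

(* The pair (u, v) stands for the monomial u(X) v(Y). *)
Definition xymonom : conomType := (xmonom * xmonom)%type.
Definition alphX2 : alphabet xymonom :=
  var_alphabet (fun i : nat => (ucm i, mone) : xymonom).
Definition alphY2 : alphabet xymonom :=
  var_alphabet (fun j : nat => (mone, ucm j) : xymonom).

(* X + Y + XY = (1 + X)(1 + Y) - 1 *)
Definition alphXYXY : alphabet xymonom :=
  @sub_letter _ (mul_alphabet (one_add alphX2) (one_add alphY2)) (None, None).

(* Positions are counted from 1 on paper and from 0 in 'I_n: there is a descent
   at the (1-based) position i when the value at the 0-based position i is
   smaller than that at the 0-based position i - 1. *)
Definition Des n (s : 'S_n) : {set 'I_n} :=
  [set i : 'I_n | [exists j : 'I_n, (j.+1 == i) && (s i < s j)%N]].

Definition partial_sums (a : seq nat) : seq nat :=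
  [seq sumn (take j a) | j <- iota 1 (size a).-1].

Definition heis_matrices (n : nat) (a b : seq nat) :
    set 'M[nat]_((size b).+1, (size a).+1) :=
  [set M | [/\ M 0 0 = 0%N,
    [seq (\sum_i M i j)%N | j <- enum 'I_(size a).+1] =
      (n - sumn a)%N :: a &
    [seq (\sum_j M i j)%N | i <- enum 'I_(size b).+1] =
      (n - sumn b)%N :: b]].
Arguments heis_matrices : clear implicits.

Definition nonzero_entries r s (M : 'M[nat]_(r, s)) : composition :=
  Sub (filter (leq 1) [seq M i j | i <- enum 'I_r, j <- enum 'I_s])
      (filter_all (leq 1) _).

Section HeisenbergCoproduct.
Context {k : fieldType}.

(* Formal power series over k, as families of coefficients. *)
Definition series (W : conomType) := W -> k^o.

Definition Mqsym (W : conomType) (Z : alphabet W) (a : composition) : series W :=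
  fun w => \sum_(z \in [set z : seq Z |
                         sorted (@letter_lt _ Z) z /\ size z = size (val a)])
             ((word_monomial z (val a) == w)%:R : k).

Definition QSym : set (series xmonom) := [set f |
  (exists d, forall w, f w != 0 -> (mdeg w <= d)%N) /\
  (forall (a : composition) (i j : seq alphX),
     sorted ltn i -> sorted ltn j ->
     size i = size (val a) -> size j = size (val a) ->
     f (word_monomial i (val a)) = f (word_monomial j (val a)))].

Definition qsym_eval (W : conomType) (Z : alphabet W) (f : series xmonom) :
    series W :=
  lcomb (Mqsym Z) (coord (Mqsym alphX) f).

Definition tensor (f g : series xmonom) : series xymonom :=
  fun w => f w.1 * g w.2.

Definition Mqsym2 (p : composition * composition) : series xymonom :=
  tensor (Mqsym alphX p.1) (Mqsym alphX p.2).

Definition QSym2 : set (series xymonom) := span Mqsym2.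

(* The direct sum of the group algebras of all symmetric groups. *)
Definition perm_space := {malg k[{n : nat & 'S_n}]}.

Definition Xdes (a : composition) : perm_space :=
  \sum_(s : 'S_(sumn (val a)) |
         [forall i in Des s, (i : nat) \in partial_sums (val a)])
    << Tagged (fun n => 'S_n) s >>.

Definition Sigma : set perm_space := span Xdes.

Definition heis_prodX (a b : composition) : perm_space :=
  let p := sumn (val a) in let q := sumn (val b) in
  \sum_(maxn p q <= n < (p + q).+1)
    \sum_(M \in heis_matrices n (val a) (val b)) Xdes (nonzero_entries M).

Definition heis_prod (u v : perm_space) : perm_space :=
  \sum_(a <- msupp (coord Xdes u)) \sum_(b <- msupp (coord Xdes v))
    ((coord Xdes u)@_a * (coord Xdes v)@_b) *: heis_prodX a b.

Definition pairing (f : series xmonom) (u : perm_space) : k :=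
  \sum_(a <- msupp (coord (Mqsym alphX) f))
    (coord (Mqsym alphX) f)@_a * (coord Xdes u)@_a.

(* The pairing of F with the tensor product of u and v. *)
Definition pairing2 (F : series xymonom) (u v : perm_space) : k :=
  \sum_(p <- msupp (coord Mqsym2 F))
    (coord Mqsym2 F)@_p *
      (pairing (Mqsym alphX p.1) u * pairing (Mqsym alphX p.2) v).

Definition is_heis_coprod (f : series xmonom) (F : series xymonom) : Prop :=
  QSym2 F /\
  forall u v, Sigma u -> Sigma v -> pairing2 F u v = pairing f (heis_prod u v).

Definition heis_coprod (f : series xmonom) : series xymonom :=
  xget 0 (is_heis_coprod f).

End HeisenbergCoproduct.

(* What follows shows that the definitions above are not degenerate: the three
   families Mqsym alphX, Mqsym2 and Xdes are linearly independent, QSym is the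
   span of the first, the sums over sets have finitely many non-zero terms, and
   the adjunction that defines heis_coprod has exactly one solution. *)

Section LinearCombinationFacts.
Context {k : fieldType} {I : choiceType} {V : lmodType k}.
Implicit Types (e : I -> V) (c : {malg k[I]}).

Lemma lcombEw (d : {fset I}) e c : (msupp c `<=` d)%fset ->
  lcomb e c = \sum_(i <- d) c@_i *: e i.
Proof.
move=> cd; rewrite /lcomb (big_fset_incl _ cd) // => i _ ic.
by rewrite mcoeff_outdom // scale0r.
Qed.

Lemma lcombD e c1 c2 : lcomb e (c1 + c2) = lcomb e c1 + lcomb e c2.
Proof.
rewrite (lcombEw e (msuppD_le c1 c2)) (lcombEw e (fsubsetUl _ (msupp c2))).
rewrite (lcombEw e (fsubsetUr (msupp c1) _)) -big_split /=.
by apply: eq_bigr => i _; rewrite mcoeffD scalerDl.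
Qed.

Lemma lcombZ e x c : lcomb e (x *: c) = x *: lcomb e c.
Proof.
rewrite (lcombEw e (msuppZ_le x c)) /lcomb scaler_sumr.
by apply: eq_bigr => i _; rewrite mcoeffZ scalerA.
Qed.

Lemma lcombU e i : lcomb e << i >> = e i.
Proof. by rewrite /lcomb msuppU oner_eq0 big_seq_fset1 mcoeffUU scale1r. Qed.

Lemma lcomb0 e : lcomb e 0 = 0.
Proof. by rewrite /lcomb msupp0 big_seq_fset0. Qed.

Lemma lcomb_sum e (J : Type) (r : seq J) (P : pred J) (F : J -> {malg k[I]}) :
  lcomb e (\sum_(j <- r | P j) F j) = \sum_(j <- r | P j) lcomb e (F j).
Proof. by apply: (big_morph _ (lcombD e) (lcomb0 e)). Qed.

Lemma lin_indepP e : (forall c, lcomb e c = 0 -> c = 0) -> lin_indep e.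
Proof.
move=> e0 c1 c2 eqc; apply/eqP; rewrite -subr_eq0; apply/eqP/e0.
by rewrite lcombD -scaleN1r lcombZ scaleN1r eqc subrr.
Qed.

Lemma coordK e c : lin_indep e -> coord e (lcomb e c) = c.
Proof. by move=> ie; rewrite /coord; case: xgetP => [_ -> /ie //|/(_ c)[]]. Qed.

Lemma coordU e i : lin_indep e -> coord e (e i) = << i >>.
Proof. by move=> ie; rewrite -[e i]lcombU coordK. Qed.

Lemma spanU e i : span e (e i).
Proof. by exists << i >> => //; rewrite lcombU. Qed.

End LinearCombinationFacts.

Lemma lcomb_fct (k : fieldType) (I : choiceType) (W : conomType)
    (e : I -> @series k W) (c : {malg k[I]}) (w : W) :
  lcomb e c w = \sum_(i <- msupp c) c@_i * e i w.
Proof. by rewrite /lcomb fct_sumE. Qed.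

Lemma mexpS (W : conomType) (m : W) n : mexp m n.+1 = mmul m (mexp m n).
Proof. by rewrite /mexp !Monoid.iteropE. Qed.

Lemma mexpU (i v : nat) n : (mexp (ucm i : xmonom) n : {cmonom nat}) v = ((i == v) * n)%N.
Proof.
elim: n => [|n IH]; first by rewrite [mexp _ _]/(mone) cm1 muln0.
by rewrite mexpS cmM cmU IH mulnS.
Qed.

Lemma word_monomial_cons (W : conomType) (A : alphabet W) x z y a :
  word_monomial (x :: z : seq A) (y :: a) =
  mmul (mexp (letter_val x) y) (word_monomial z a).
Proof. by rewrite /word_monomial big_cons. Qed.

Lemma word_monomialE (z : seq alphX) (a : seq nat) v :
  uniq z -> size z = size a ->
  (word_monomial z a : {cmonom nat}) v = nth 0%N a (index v z).
Proof.
elim: z a => [|x z IH] [|y a] //=; first by rewrite /word_monomial big_nil cm1.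
case/andP=> xz uz [] sz; rewrite word_monomial_cons cmM mexpU IH //.
case: eqVneq xz => [->|_] xz; last by rewrite mul0n.
by rewrite mul1n nth_default ?addn0 // -sz leqNgt index_mem.
Qed.

Lemma comp_nth_gt0 (a : composition) i : (i < size (val a))%N ->
  (0 < nth 0%N (val a) i)%N.
Proof. by move/all_nthP: (valP a); apply. Qed.

Lemma finsupp_word (z : seq alphX) (a : composition) :
  uniq z -> size z = size (val a) ->
  finsupp (word_monomial z (val a) : {cmonom nat}) =i (z : seq nat).
Proof.
move=> uz sz v; rewrite -cmE_neq0 word_monomialE //.
rewrite -index_mem sz; case: ltnP => [lt|ge].
  by rewrite -lt0n comp_nth_gt0.
by rewrite nth_default // eqxx.
Qed.

Lemma sorted_ltn_uniq (z : seq nat) : sorted ltn z -> uniq z.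
Proof. exact: (sorted_uniq ltn_trans ltnn). Qed.

Lemma word_monomial_inj (z z' : seq alphX) (a a' : composition) :
  sorted ltn z -> sorted ltn z' ->
  size z = size (val a) -> size z' = size (val a') ->
  word_monomial z (val a) = word_monomial z' (val a') -> z = z' /\ a = a'.
Proof.
move=> sz sz' za za' eqw.
have uz := sorted_ltn_uniq sz; have uz' := sorted_ltn_uniq sz'.
have ez : z = z'.
  apply: (irr_sorted_eq ltn_trans ltnn) => // v.
  by rewrite -(finsupp_word uz za) -(finsupp_word uz' za') eqw.
split=> //; apply/val_inj/(@eq_from_nth _ 0%N); first by rewrite -za -za' ez.
move=> i; rewrite -za => iz.
have := congr1 (fun m : {cmonom nat} => m (nth 0%N z i)) eqw.
by rewrite !word_monomialE // -ez index_uniq.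
Qed.

Lemma ex_word (w : xmonom) : exists (z : seq alphX) (a : composition),
  [/\ sorted ltn z, size z = size (val a) & w = word_monomial z (val a)].
Proof.
pose z : seq nat := sort leq (finsupp (w : {cmonom nat})).
have mz v : (v \in z) = ((w : {cmonom nat}) v != 0%N).
  by rewrite mem_sort cmE_neq0.
have ap : all (leq 1) [seq (w : {cmonom nat}) v | v <- z].
  by apply/allP => _ /mapP[v vz ->]; rewrite lt0n -mz.
have uz : uniq z by rewrite sort_uniq fset_uniq.
exists z, (Sub _ ap); rewrite SubK size_map; split=> //.
  by rewrite ltn_sorted_uniq_leq uz sort_sorted //; apply: leq_total.
apply/eqP/cmP => v; rewrite word_monomialE ?size_map //.
have [vz|] := boolP (v \in z); first by rewrite (nth_map 0%N) ?nth_index ?index_mem.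
rewrite -index_mem -leqNgt => vz; rewrite nth_default ?size_map //.
by move: vz; rewrite leqNgt index_mem mz negbK => /eqP.
Qed.

Section Facts.
Context {k : fieldType}.

Lemma Mqsym_word (b a : composition) (z : seq alphX) :
  sorted ltn z -> size z = size (val a) ->
  Mqsym alphX b (word_monomial z (val a)) = (b == a)%:R :> k.
Proof.
move=> sz za; rewrite /Mqsym /=.
have [->|ba] := eqVneq b a.
  rewrite -(@fsbig_widen _ _ _ _ [set z]) ?fsbig_set1 ?eqxx //.
    by move=> _ ->.
  move=> z' [] [sz' za'] /= zz'; case: eqP => // e.
  by have [/zz'] := word_monomial_inj sz' sz za' za e.
rewrite fsbig1 // => z' [sz' za']; case: eqP => // e.
by have [_ eab] := word_monomial_inj sz' sz za' za e; rewrite eab eqxx in ba.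
Qed.

Lemma lcomb_Mqsym_word (c : {malg k[composition]}) (a : composition)
    (z : seq alphX) : sorted ltn z -> size z = size (val a) ->
  lcomb (Mqsym alphX) c (word_monomial z (val a)) = c@_a.
Proof.
move=> sz za; rewrite lcomb_fct.
under eq_bigr do rewrite Mqsym_word //.
have [ac|ac] := msuppP c a; last first.
  rewrite big_seq big1 // => b bc; case: eqP => [eab|_]; last by rewrite mulr0.
  by rewrite -eab bc in ac.
rewrite (big_fsetD1 a) //= eqxx mulr1 big1_fset ?addr0 // => b.
by rewrite in_fsetD1 => /andP[/negPf-> _]; rewrite mulr0.
Qed.

Definition first_word (a : composition) : seq alphX := iota 0 (size (val a)).
Lemma first_word_sorted a : sorted ltn (first_word a).
Proof. exact: iota_ltn_sorted. Qed.
Lemma first_word_size a : size (first_word a) = size (val a).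
Proof. exact: size_iota. Qed.

Lemma Mqsym_indep : lin_indep (@Mqsym k _ alphX).
Proof.
apply: lin_indepP => c c0; apply/malgP => a; rewrite mcoeff0.
rewrite -(lcomb_Mqsym_word c (first_word_sorted a) (first_word_size a)).
by rewrite c0.
Qed.

Lemma Mqsym2_indep : lin_indep (@Mqsym2 k).
Proof.
apply: lin_indepP => c c0; apply/malgP => -[a b]; rewrite mcoeff0.
have := congr1 (fun f => f (word_monomial (first_word a) (val a),
                            word_monomial (first_word b) (val b))) c0.
rewrite lcomb_fct => c0w; rewrite -[RHS]c0w /Mqsym2 /tensor /= => {c0 c0w}.
have E (p : composition * composition) :
    Mqsym alphX p.1 (word_monomial (first_word a) (val a)) *
    Mqsym alphX p.2 (word_monomial (first_word b) (val b)) =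
    (p == (a, b))%:R :> k.
  case: p => a' b' /=; rewrite !Mqsym_word ?first_word_size ?first_word_sorted //.
  by rewrite xpair_eqE -natrM mulnb.
under eq_bigr do rewrite E.
have [ac|ac] := msuppP c (a, b); last first.
  rewrite big_seq big1 // => p pc; case: eqP => [ep|_]; last by rewrite mulr0.
  by rewrite -ep pc in ac.
rewrite (big_fsetD1 (a, b)) //= eqxx mulr1 big1_fset ?addr0 // => p.
by rewrite in_fsetD1 => /andP[/negPf-> _]; rewrite mulr0.
Qed.

Lemma mdeg_word (z : seq alphX) (a : seq nat) : size z = size a ->
  mdeg (word_monomial z a : {cmonom nat}) = sumn a.
Proof.
elim: z a => [|x z IH] [|y a] //=; first by rewrite /word_monomial big_nil mdeg1.
move=> [] sz; rewrite word_monomial_cons mdegM IH //; congr (_ + _)%N.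
elim: y => [|y IHy]; first by rewrite [mexp _ _]/(mone) mdeg1.
by rewrite mexpS mdegM IHy mdegU.
Qed.

Lemma size_comp (a : composition) : (size (val a) <= sumn (val a))%N.
Proof.
case: a => /= a; elim: a => //= x a IH /andP[x0 /IH]; lia.
Qed.

Lemma mem_leq_sumn (s : seq nat) x : x \in s -> (x <= sumn s)%N.
Proof.
elim: s => //= y s IH; rewrite inE => /orP[/eqP->|/IH xs]; first exact: leq_addr.
exact: leq_trans xs (leq_addl _ _).
Qed.

Lemma finite_comps d : finite_set [set a : composition | (sumn (val a) <= d)%N].
Proof.
pose g (t : d.-bseq 'I_d.+1) : composition :=
  insubd (Sub [::] isT) [seq val i | i <- val t].
apply: (@sub_finite_set _ _ (range g)); last by apply: finite_image; apply: finite_finset.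
move=> a /= ad.
have aP : (size [seq (inord x : 'I_d.+1) | x <- val a] <= d)%N.
  by rewrite size_map; apply: leq_trans ad; apply: size_comp.
have E : [seq val i | i <- [seq (inord x : 'I_d.+1) | x <- val a]] = val a.
  rewrite -map_comp map_id_in // => x xa /=.
  rewrite inordK // ltnS; apply: leq_trans ad.
  exact: mem_leq_sumn.
exists (Bseq aP) => //; apply: val_inj; rewrite val_insubd /= E.
by case: ifP => //; rewrite (valP a).
Qed.

Lemma Mqsym_QSym a : QSym (@Mqsym k _ alphX a).
Proof.
split=> [|b i j si sj ib jb]; last by rewrite !Mqsym_word.
exists (sumn (val a)) => w; have [z [b [sz zb ->]]] := ex_word w.
rewrite Mqsym_word //; have [->|_] := eqVneq a b; last by rewrite eqxx.
by rewrite mdeg_word.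
Qed.

Lemma QSym_span : @QSym k = span (Mqsym alphX).
Proof.
apply/seteqP; split=> [f [[d fd] fq]|_ [c _ <-]].
  pose S := fset_set [set a : composition | (sumn (val a) <= d)%N].
  exists (\sum_(a <- S) << f (word_monomial (first_word a) (val a)) *g a >>) => //.
  apply/funext => w; have [z [a [sz za ->]]] := ex_word w.
  rewrite lcomb_Mqsym_word // raddf_sum /=.
  under eq_bigr do rewrite mcoeffU.
  rewrite (fq a z (first_word a)) ?first_word_sorted ?first_word_size //.
  have [aS|aS] := boolP (a \in S).
    rewrite (big_fsetD1 a) //= eqxx mulr1n big1_fset ?addr0 // => b.
    by rewrite in_fsetD1 => /andP[/negPf-> _]; rewrite mulr0n.
  rewrite big_seq big1 => [|b bS]; last first.
    by case: eqP => [eab|//]; rewrite -eab bS in aS.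
  apply/esym/eqP; apply: contraR aS => /fd; rewrite mdeg_word ?first_word_size //.
  by move=> ad; rewrite in_fset_set ?inE //; apply: finite_comps.
split.
  exists (\sum_(a <- msupp c) sumn (val a))%N => w.
  have [z [a [sz za ->]]] := ex_word w; rewrite lcomb_Mqsym_word // mcoeff_neq0.
  by move=> ac; rewrite mdeg_word // (big_fsetD1 a) //= leq_addr.
by move=> a i j si sj ia ja; rewrite !lcomb_Mqsym_word.
Qed.

Lemma ex_Des n (D : {set 'I_n}) : (forall i, i \in D -> (0 < i)%N) ->
  exists s : 'S_n, Des s = D.
Proof.
move=> D0; pose h (i : nat) := #|[set d in D | (d <= i)%N]%SET|.
pose prec (j i : 'I_n) := (h i < h j)%N || (h i == h j) && (j < i)%N.
pose r (i : 'I_n) := #|[set j | prec j i]%SET|.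
have prec_irr i : prec i i = false by rewrite /prec !ltnn andbF.
have prec_tr j i l : prec j i -> prec i l -> prec j l by rewrite /prec; lia.
have prec_r i j : prec i j -> (r i < r j)%N.
  move=> ij; apply/proper_card/properP; split.
    by apply/fintype.subsetP => l; rewrite !inE => /prec_tr; apply.
  by exists i; rewrite inE ?prec_irr.
have r_lt i : (r i < n)%N.
  rewrite -[X in (_ < X)%N]card_ord -cardsT; apply/proper_card/properP; split.
    exact: finset.subsetT.
  by exists i; rewrite inE ?prec_irr.
have prec_tot i j : i != j -> prec i j || prec j i.
  by rewrite -val_eqE /prec /=; lia.
have s_inj : injective (fun i => Ordinal (r_lt i)).
  move=> i j [] rij; apply/eqP; apply: contraT => /prec_tot /orP[] /prec_r; lia.
exists (perm s_inj); apply/setP => i; rewrite inE; apply/existsP/idP.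
  case=> j /andP[/eqP ji]; rewrite !permE /= => rij.
  have pij : prec i j.
    have ij : i != j by rewrite -val_eqE /= -ji; lia.
    by case/orP: (prec_tot _ _ ij) => // /prec_r; lia.
  apply: contraTT pij => iD; rewrite /prec.
  suff -> : h i = h j by lia.
  apply: eq_card => d; rewrite !inE; case: (boolP (d \in D)) => //= dD.
  have : d != i by apply: contraNneq iD => <-.
  by rewrite -val_eqE /=; lia.
move=> iD; have i0 := D0 _ iD.
have jn : (i.-1 < n)%N by apply: leq_ltn_trans (ltn_ord i); lia.
exists (Ordinal jn); rewrite /= prednK // eqxx !permE /=; apply: prec_r.
rewrite /prec; apply/orP; left; apply/proper_card/properP; split.
  by apply/fintype.subsetP => d; rewrite !inE => /andP[-> /=]; lia.
by exists i; rewrite !inE iD /=; lia.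
Qed.

Lemma size_partial_sums a : size (partial_sums a) = (size a).-1.
Proof. by rewrite size_map size_iota. Qed.

Lemma nth_partial_sums a i : (i < (size a).-1)%N ->
  nth 0%N (partial_sums a) i = sumn (take i.+1 a).
Proof. by move=> ia; rewrite (nth_map 0%N) ?size_iota // nth_iota. Qed.

Lemma sumn_take_ltn (a : composition) i j : (i < j)%N ->
  (j <= size (val a))%N -> (sumn (take i (val a)) < sumn (take j (val a)))%N.
Proof.
case: a => /= a; elim: a i j => [|x a IH] [|i] [|j] //=; first by lia.
by case/andP => _ /IH{}IH ij ja; rewrite ltn_add2l; apply: IH.
Qed.

Lemma partial_sums_sorted (a : composition) : sorted ltn (partial_sums (val a)).
Proof.
apply/(sortedP 0%N) => i; rewrite size_partial_sums => ia.
rewrite !nth_partial_sums ?(ltnW ia) //; apply: sumn_take_ltn => //; lia.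
Qed.

Lemma partial_sums_bound (a : composition) i : i \in partial_sums (val a) ->
  (0 < i < sumn (val a))%N.
Proof.
case/mapP => j; rewrite mem_iota => /andP[j0 jr] ->.
have ja : (j < size (val a))%N by move: jr; case: (size (val a)) => [|m]; lia.
have := sumn_take_ltn j0 (ltnW ja); rewrite take0 => -> /=.
by have := sumn_take_ltn ja (leqnn _); rewrite take_size.
Qed.

Lemma partial_sums_inj (a b : composition) : sumn (val a) = sumn (val b) ->
  size (val a) = size (val b) -> partial_sums (val a) = partial_sums (val b) ->
  a = b.
Proof.
move=> sab zab pab; apply/val_inj.
have tE j : (j <= size (val a))%N -> sumn (take j (val a)) = sumn (take j (val b)).
  rewrite leq_eqVlt => /orP[/eqP->|ja]; first by rewrite {2}zab !take_size.
  case: j ja => [|j] ja; first by rewrite !take0.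
  by rewrite -!nth_partial_sums -?zab ?pab //; lia.
apply: (@eq_from_nth _ 0%N) => // i ia.
have := tE _ ia; rewrite !(take_nth 0%N) -?zab // !sumn_rcons tE; last exact: ltnW.
by move/addnI.
Qed.

Lemma comp_eq_subset (a b : composition) : sumn (val a) = sumn (val b) ->
  {subset partial_sums (val a) <= partial_sums (val b)} ->
  (size (val b) <= size (val a))%N -> a = b.
Proof.
move=> sab sub ba.
have ua := sorted_ltn_uniq (partial_sums_sorted a).
have ub := sorted_ltn_uniq (partial_sums_sorted b).
have le : (size (partial_sums (val b)) <= size (partial_sums (val a)))%N.
  by rewrite !size_partial_sums; lia.
have [_ eqi] := uniq_min_size ua sub le.
have epl : partial_sums (val a) = partial_sums (val b).
  exact: (irr_sorted_eq ltn_trans ltnn (partial_sums_sorted a)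
            (partial_sums_sorted b) eqi).
have esz : (size (val a)).-1 = (size (val b)).-1.
  by rewrite -!size_partial_sums epl.
apply: partial_sums_inj => //.
have [a0|a0] := posnP (size (val a)); first by move: ba; rewrite a0 leqn0 => /eqP.
have [b0|b0] := posnP (size (val b)); last by lia.
move: a0 sab; rewrite (size0nil b0); case: (val a) (valP a) => //= x s.
by case/andP; lia.
Qed.

Lemma Xdes_coeff (a : composition) n (s : 'S_n) :
  (Xdes a : perm_space)@_(Tagged (fun n => 'S_n) s) =
  ((n == sumn (val a)) &&
   [forall i in Des s, (i : nat) \in partial_sums (val a)])%:R :> k.
Proof.
rewrite /Xdes raddf_sum /=.
have [en|nn] := eqVneq n (sumn (val a)); last first.
  rewrite big1 // => t _; rewrite mcoeffU; case: eqP => // /(congr1 tag) /= en.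
  by rewrite en eqxx in nn.
subst n; under eq_bigr => t _ do rewrite mcoeffU eq_Tagged /=.
rewrite big_mkcond (bigD1 s) //= eqxx big1 ?addr0 ?mulr1n => [|t ts].
  by case: ifP.
by rewrite (negPf ts) if_same.
Qed.

Lemma ex_perm_Des (a : composition) : exists s : 'S_(sumn (val a)),
  forall i : nat, (i \in partial_sums (val a)) =
    [exists j in Des s, (j : nat) == i].
Proof.
have [|s sE] := @ex_Des (sumn (val a))
  [set i : 'I_(sumn (val a)) | (i : nat) \in partial_sums (val a)]%SET.
  by move=> i; rewrite inE => /partial_sums_bound /andP[].
exists s => i; apply/idP/existsP => [ia|[j /andP[]]]; last first.
  by rewrite sE inE => ja /eqP<-.
have /andP[_ ilt] := partial_sums_bound ia.
by exists (Ordinal ilt); rewrite sE inE ia /=.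
Qed.

Lemma Xdes_indep : lin_indep (@Xdes k).
Proof.
apply: lin_indepP => c c0; apply/eqP/contraT => cn0.
have [a ac amax] : exists2 a, a \in msupp c &
    forall b, b \in msupp c -> (size (val b) <= size (val a))%N.
  have [a0 a0c] : exists a, a \in msupp c.
    case: (fset_0Vmem (msupp c)) => [e0|[a0 a0c]]; last by exists a0.
    case/eqP: cn0; apply/malgP => a.
    by rewrite mcoeff0 mcoeff_outdom // e0 in_fset0.
  have P : exists n, [exists a : msupp c, size (val (val a)) == n].
    by exists (size (val a0)); apply/existsP; exists [` a0c]%fset; rewrite /= eqxx.
  have B n : [exists a : msupp c, size (val (val a)) == n] ->
      (n <= \sum_(a <- msupp c) size (val a))%N.
    case/existsP => -[a ac] /= /eqP <-.
    by rewrite (big_fsetD1 a) //= leq_addr.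
  case: (ex_maxnP P B) => _ /existsP[[a ac] /= /eqP<-] amax.
  exists a => // b bc; apply: amax; apply/existsP; exists [` bc]%fset.
  by rewrite /= eqxx.
have [s sE] := ex_perm_Des a.
have := congr1 (mcoeff (Tagged (fun n => 'S_n) s)) c0.
rewrite mcoeff0 /lcomb raddf_sum /=.
under eq_bigr do rewrite mcoeffZ Xdes_coeff.
rewrite (big_fsetD1 a) //= big1_fset => [|b]; last first.
  rewrite in_fsetD1 => /andP[ba bc] _; case: andP => [[/eqP sab /forallP h]|_].
    case/eqP: ba; apply/esym/comp_eq_subset => //; last exact: amax.
    move=> i; rewrite sE => /existsP[j /andP[jD /eqP<-]].
    by move: (h j); rewrite jD.
  by rewrite mulr0.
rewrite eqxx addr0 (_ : [forall i in Des s, _]) ?mulr1 => [/eqP|].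
  by rewrite mcoeff_eq0 ac.
apply/forallP => i; apply/implyP => iD; rewrite sE; apply/existsP; exists i.
by rewrite iD /=.
Qed.

Lemma finite_heis_matrices n a b : finite_set (heis_matrices n a b).
Proof.
pose N := (n + sumn a)%N.
pose g (M : 'M['I_N.+1]_((size b).+1, (size a).+1)) : 'M[nat]_(_, _) :=
  map_mx (@nat_of_ord _) M.
apply: (@sub_finite_set _ _ (range g)).
  move=> M [_ Mc _]; exists (map_mx inord M) => //.
  apply/matrixP => i j; rewrite !mxE inordK // ltnS.
  apply: leq_trans (_ : (\sum_i M i j <= N)%N); first by rewrite (bigD1 i) ?leq_addr.
  have : (\sum_i M i j)%N \in (n - sumn a)%N :: a.
    by rewrite -Mc; apply: map_f; rewrite mem_enum.
  by rewrite inE => /orP[/eqP->|/mem_leq_sumn]; rewrite /N; lia.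
by apply: finite_image; apply: finite_finset.
Qed.

Lemma sumn_nonzero_entries r s (M : 'M[nat]_(r, s)) :
  sumn (val (nonzero_entries M)) = (\sum_i \sum_j M i j)%N.
Proof.
have F (l : seq nat) : sumn (filter (leq 1) l) = sumn l.
  by elim: l => //= x l IH; case: x => //= x; rewrite IH.
rewrite SubK F.
rewrite sumnE big_allpairs_dep /= big_enum /=; apply: eq_bigr => i _.
by rewrite big_enum.
Qed.

Lemma heis_matrices_size n (a b : composition) M : (sumn (val a) <= n)%N ->
  heis_matrices n (val a) (val b) M -> sumn (val (nonzero_entries M)) = n.
Proof.
move=> an [_ Mc _]; rewrite sumn_nonzero_entries exchange_big /=.
have := congr1 sumn Mc; rewrite sumnE big_map big_enum /= => ->.
by rewrite subnK.
Qed.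

Definition heis_coord (a b : composition) : {malg k[composition]} :=
  let p := sumn (val a) in let q := sumn (val b) in
  \sum_(maxn p q <= n < (p + q).+1)
    \sum_(M <- fset_set (heis_matrices n (val a) (val b))) << nonzero_entries M >>.

Lemma heis_prodXE a b : heis_prodX a b = lcomb Xdes (heis_coord a b).
Proof.
rewrite /heis_prodX /heis_coord lcomb_sum; apply: eq_bigr => n _.
rewrite lcomb_sum fsbig_finite /=; last exact: finite_heis_matrices.
by apply: eq_bigr => M _; rewrite lcombU.
Qed.

Lemma heis_coord_size a b c : c \in msupp (heis_coord a b) ->
  (sumn (val a) <= sumn (val c))%N && (sumn (val b) <= sumn (val c))%N.
Proof.
apply: contraTT => h; rewrite -mcoeff_eq0 /heis_coord raddf_sum /=.
rewrite big_nat_cond big1 // => n /andP[/andP[n1 n2] _].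
rewrite raddf_sum /= big_seq big1 // => M; rewrite in_fset_set; last first.
  exact: finite_heis_matrices.
rewrite inE mcoeffU => MM; case: eqP => [ec|//]; case/negP: h.
by rewrite -ec (heis_matrices_size _ MM); move: n1; rewrite geq_max => /andP[->].
Qed.

Lemma pairing_lcomb (c d : {malg k[composition]}) :
  pairing (lcomb (Mqsym alphX) c) (lcomb Xdes d) =
  lcomb (fun a => d@_a : k^o) c.
Proof.
by rewrite /pairing !coordK //; [exact: Xdes_indep|exact: Mqsym_indep].
Qed.

Lemma pairingMX a b : pairing (Mqsym alphX a) (Xdes b) = (a == b)%:R :> k.
Proof.
by rewrite -[Mqsym _ a]lcombU -[Xdes b]lcombU pairing_lcomb lcombU mcoeffU eq_sym.
Qed.

Lemma pairing2_lcomb (C : {malg k[(composition * composition)%type]})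
    (c d : {malg k[composition]}) :
  pairing2 (lcomb Mqsym2 C) (lcomb Xdes c) (lcomb Xdes d) =
  lcomb (fun p => c@_p.1 * d@_p.2 : k^o) C.
Proof.
rewrite /pairing2 coordK; last exact: Mqsym2_indep.
apply: eq_bigr => p _; rewrite -[Mqsym _ p.1]lcombU -[Mqsym _ p.2]lcombU.
by rewrite !pairing_lcomb !lcombU.
Qed.

Lemma lcombCr (c d : {malg k[composition]}) :
  lcomb (fun a => d@_a : k^o) c = lcomb (fun a => c@_a : k^o) d.
Proof.
rewrite (lcombEw _ (fsubsetUl (msupp c) (msupp d))).
rewrite (lcombEw _ (fsubsetUr (msupp c) (msupp d))).
by apply: eq_bigr => i _; exact: mulrC.
Qed.

Lemma tensor_lcomb (c d : {malg k[composition]}) :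
  tensor (lcomb (Mqsym alphX) c) (lcomb (Mqsym alphX) d) =
  lcomb Mqsym2 (\sum_(a <- msupp c) \sum_(b <- msupp d) (c@_a * d@_b) *: << (a, b) >>).
Proof.
apply/funext => -[w1 w2]; rewrite /tensor /= (lcomb_fct _ c) (lcomb_fct _ d) big_distrl /=.
rewrite lcomb_sum fct_sumE; apply: eq_bigr => a _.
rewrite lcomb_sum fct_sumE big_distrr /=; apply: eq_bigr => b _.
by rewrite lcombZ lcombU /= mulrACA.
Qed.

Lemma pairing2_tensor (f g : series xmonom) (u v : perm_space) :
  QSym f -> QSym g -> Sigma u -> Sigma v ->
  pairing2 (tensor f g) u v = pairing f u * pairing g v :> k.
Proof.
rewrite QSym_span => -[c _ <-] [d _ <-] [x _ <-] [y _ <-].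
rewrite tensor_lcomb pairing2_lcomb !pairing_lcomb lcomb_sum [RHS]big_distrl /=.
apply: eq_bigr => a _; rewrite lcomb_sum big_distrr /=; apply: eq_bigr => b _.
by rewrite lcombZ lcombU /= mulrACA.
Qed.

Lemma heis_prod_lcomb (c d : {malg k[composition]}) :
  heis_prod (lcomb Xdes c) (lcomb Xdes d) =
  lcomb Xdes (\sum_(a <- msupp c) \sum_(b <- msupp d)
                (c@_a * d@_b) *: heis_coord a b).
Proof.
rewrite /heis_prod !coordK; try exact: Xdes_indep.
rewrite lcomb_sum; apply: eq_bigr => a _; rewrite lcomb_sum; apply: eq_bigr => b _.
by rewrite lcombZ heis_prodXE.
Qed.

Lemma heis_prodXX a b : heis_prod (Xdes a) (Xdes b) = heis_prodX a b :> @perm_space k.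
Proof.
rewrite -[Xdes a]lcombU -[Xdes b]lcombU heis_prod_lcomb heis_prodXE.
by rewrite !msuppU oner_eq0 !big_seq_fset1 !mcoeffUU mulr1 scale1r.
Qed.

Lemma is_heis_coprod_ex (f : series xmonom) :
  QSym f -> exists F, is_heis_coprod (k := k) f F.
Proof.
rewrite QSym_span => -[cf _ <-].
pose G a b : k := lcomb (fun c => (heis_coord a b)@_c : k^o) cf.
pose D := (\sum_(c <- msupp cf) sumn (val c))%N.
pose S := fset_set [set a : composition | (sumn (val a) <= D)%N].
have SP a : (a \in S) = (sumn (val a) <= D)%N.
  rewrite in_fset_set; last exact: finite_comps.
  by apply/idP/idP; rewrite inE.
have G0 a b : (a \notin S) || (b \notin S) -> G a b = 0.
  move=> ab; rewrite /G /lcomb big_seq big1 // => c cc.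
  rewrite (@mcoeff_outdom _ _ (heis_coord a b)) ?scaler0 //; apply: contraL ab.
  move/heis_coord_size => /andP[ac bc]; rewrite negb_or !negbK !SP.
  suff cD : (sumn (val c) <= D)%N by rewrite (leq_trans ac cD) (leq_trans bc cD).
  by rewrite /D (big_fsetD1 c) //= leq_addr.
exists (lcomb Mqsym2 (\sum_(a <- S) \sum_(b <- S) G a b *: << (a, b) >>)).
split; first by eexists.
move=> _ _ [c _ <-] [d _ <-]; rewrite heis_prod_lcomb pairing_lcomb pairing2_lcomb.
rewrite lcombCr !lcomb_sum.
pose T := (S `|` msupp c `|` msupp d)%fset.
have ST : (S `<=` T)%fset by rewrite /T -fsetUA fsubsetUl.
have cT : (msupp c `<=` T)%fset.
  by rewrite /T -fsetUA; apply: fsubset_trans (fsubsetUr _ _); exact: fsubsetUl.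
have dT : (msupp d `<=` T)%fset by exact: fsubsetUr.
transitivity (\sum_(a <- T) \sum_(b <- T) G a b * (c@_a * d@_b)).
  rewrite (big_fset_incl _ ST) => [|a _ aS]; last first.
    rewrite lcomb_sum big1 // => b _; rewrite G0 ?aS // scale0r; exact: lcomb0.
  apply: eq_bigr => a _; rewrite lcomb_sum (big_fset_incl _ ST) => [|b _ bS].
    by apply: eq_bigr => b _; rewrite lcombZ lcombU.
  by rewrite G0 ?bS ?orbT // scale0r; exact: lcomb0.
rewrite -(big_fset_incl _ cT) => [|a _ ac]; last first.
  by rewrite big1 // => b _; rewrite (mcoeff_outdom ac) mul0r mulr0.
apply: eq_bigr => a _; rewrite lcomb_sum -(big_fset_incl _ dT) => [|b _ bd].
  by apply: eq_bigr => b _; rewrite lcombZ mulrC /G lcombCr.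
by rewrite (mcoeff_outdom bd) !mulr0.
Qed.

Lemma is_heis_coprod_uniq (f : series xmonom) F F' :
  is_heis_coprod (k := k) f F -> is_heis_coprod f F' -> F = F'.
Proof.
case=> -[C _ <-] hC [[C' _ <-] hC']; congr lcomb; apply/malgP => -[a b].
have coefE (E : {malg k[(composition * composition)%type]}) :
    pairing2 (lcomb Mqsym2 E) (Xdes a) (Xdes b) = E@_(a, b).
  rewrite -[Xdes a]lcombU -[Xdes b]lcombU pairing2_lcomb.
  have -> : (fun p => << a >>@_p.1 * << b >>@_p.2 : k^o) =
      (fun p => (<< (a, b) >> : {malg k[(composition * composition)%type]})@_p : k^o).
    apply/funext => -[x y] /=; rewrite !mcoeffU xpair_eqE -mulnb natrM.
    by [].
  rewrite (lcombEw _ (fsubsetUl (msupp E) [fset (a, b)]%fset)).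
  rewrite (big_fsetD1 (a, b)) /=; last by rewrite !inE eqxx orbT.
  rewrite mcoeffUU big1_fset => [|p]; first by rewrite addr0; exact: mulr1.
  rewrite in_fsetD1 => /andP[pab _] _.
  by rewrite mcoeffU eq_sym (negPf pab) mulr0n scaler0.
by rewrite -!coefE hC ?hC' //; exact: spanU.
Qed.

Lemma heis_coprodP (f : series xmonom) :
  QSym f -> is_heis_coprod (k := k) f (heis_coprod f).
Proof.
move=> /is_heis_coprod_ex [F hF]; rewrite /heis_coprod.
by case: xgetP => [_ -> //|/(_ F)].
Qed.

Lemma qsym_eval_alphX (f : @series k xmonom) : QSym f -> qsym_eval alphX f = f.
Proof.
by rewrite QSym_span => -[c _ <-]; rewrite /qsym_eval coordK //; exact: Mqsym_indep.
Qed.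

Lemma heis_coprod_eq (f : @series k xmonom) F :
  QSym f -> is_heis_coprod f F -> heis_coprod f = F.
Proof. by move=> /heis_coprodP /is_heis_coprod_uniq; apply. Qed.

End Facts.

Lemma finite_words (W : conomType) (Z : alphabet W) (a : composition) (w : W) :
  (forall w, finite_set [set l : Z | exists w', w = mmul (letter_val l) w']) ->
  finite_set [set z : seq Z | size z = size (val a) /\
                              word_monomial z (val a) = w].
Proof.
move=> fin; pose L := fset_set [set l : Z | exists w', w = mmul (letter_val l) w'].
pose g (t : (size (val a)).-tuple L) : seq Z := [seq val l | l <- val t].
apply: (@sub_finite_set _ _ (range g)); last by apply: finite_image; apply: finite_finset.
move=> z [za zw].
have zL : all (fun l => l \in L) z.
  apply/allP => l lz; rewrite in_fset_set; last exact: fin.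
  rewrite inE /= -zw => {zw}; case: a {g} za => /= a.
  elim: z a lz => //= x z IH [|y a] //=; rewrite inE.
  case/orP=> [/eqP->|lz] /andP[y0 a0] [za]; rewrite word_monomial_cons.
    by case: y y0 => // y _; rewrite mexpS -mulmA; eexists.
  have [w' ->] := IH a lz a0 za.
  by exists (mmul (mexp (letter_val x) y) w'); rewrite !mulmA (mulmC (letter_val l)).
have zE : [seq val l | l <- pmap (insub : Z -> option L) z] = z.
  by rewrite pmap_filter; [apply/all_filterP; apply: sub_all zL => l lL; rewrite insubT|exact: insubK].
have zs : size (pmap (insub : Z -> option L) z) == size (val a).
  by rewrite -za -{2}zE size_map.
by exists (Tuple zs).
Qed.

Lemma alphXYXY_finite (a : composition) (w : xymonom) :
  finite_set [set z : seq alphXYXY | size z = size (val a) /\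
                                     word_monomial z (val a) = w].
Proof.
apply: finite_words => -[u v].
pose A := (None |` [fset Some i | i in finsupp (u : {cmonom nat})])%fset.
pose B := (None |` [fset Some i | i in finsupp (v : {cmonom nat})])%fset.
pose g (p : A * B) : alphXYXY :=
  insubd (Sub (Some 0%N, None) isT) (val p.1, val p.2).
apply: (@sub_finite_set _ _ (range g)); last by apply: finite_image; apply: finite_finset.
case=> -[x y] /= xy0 [[u' v']]; rewrite /letter_val /= => -[eu ev].
have xA : x \in A.
  move: eu; case: (x) => [i|] eu; rewrite !inE //=; apply/imfsetP; exists i => //=.
  by rewrite -cmE_neq0 eu; case: (y) => [j|] /=; rewrite !cmM cmUU.
have yB : y \in B.
  move: ev; case: (y) => [j|] ev; rewrite !inE //=; apply/imfsetP; exists j => //=.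
  by rewrite -cmE_neq0 ev; case: (x) => [i|] /=; rewrite !cmM cmUU ?addnA ?addn1.
exists ([` xA]%fset, [` yB]%fset) => //; apply: val_inj.
by rewrite val_insubd /= xy0.
Qed.

(* Main.v *)
(* Reading a matrix in row-major order lists its cells in the reverse
   lexicographic order of (1 + X)(1 + Y). So fix increasing words zx and zy with
   exponents a and b, label the columns of a matrix M by x_0 and the letters of
   zx and its rows by y_0 and the letters of zy: the labels of the non-zero cells
   of M form an increasing word of X + Y + XY, which, raised to the entries c(M),
   is the monomial zx^a zy^b exactly when M has column sums ( * , a) and row sums
   ( * , b). Hence the coefficient of zx^a zy^b in M_c(X + Y + XY) is the number
   of such M with c(M) = c, which is the coefficient of X_c in X_a # X_b. *)

Require Import Defs.
From mathcomp Require Import all_boot all_order all_algebra finmap zify.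
From mathcomp Require Import boolp functions cardinality fsbigop.
From mathcomp.multinomials Require Import monalg.
From mathcomp Require Import classical_sets.

Set Implicit Arguments.
Unset Strict Implicit.
Unset Printing Implicit Defensive.

Import GRing.Theory.

(** * Lists indexed by ordinals, and increasing words of pairs *)

Lemma map_enum_ordP (T : Type) (x0 : T) m (F : 'I_m -> T) (s : seq T) :
  size s = m ->
  [seq F j | j <- enum 'I_m] = s <-> forall j : 'I_m, F j = nth x0 s j.
Proof.
move=> sm; split=> [<- j|Fs].
  by rewrite (nth_map j) ?size_enum_ord // nth_ord_enum.
apply: (@eq_from_nth _ x0); rewrite size_map size_enum_ord // => j jm.
by rewrite (nth_map (Ordinal jm)) ?size_enum_ord // Fs nth_enum_ord.
Qed.

Lemma map_nth_enum_ord (T : Type) (x0 : T) (s : seq T) m :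
  size s = m -> [seq nth x0 s j | j : 'I_m <- enum 'I_m] = s.
Proof. by move=> sm; apply/(map_enum_ordP x0 _ sm). Qed.

(** The second letter dominates the reverse lexicographic order, so [t] runs in the outer loop; its
    letters will label the rows of a matrix. *)
Lemma allpairs_revlex_sorted (W : conomType) (A B : alphabet W)
    (s : seq A) (t : seq B) :
  sorted (@letter_lt _ A) s -> sorted (@letter_lt _ B) t ->
  sorted (@letter_lt _ (mul_alphabet A B)) [seq (x, y) | y <- t, x <- s].
Proof.
rewrite !sorted_pairwise; try exact: letter_trans.
move=> ss; elim: t => //= y t IH /andP[yt /IH {}IH].
rewrite pairwise_cat IH andbT; apply/andP; split.
  apply/allrelP => _ _ /mapP[x _ ->] /allpairsP[[y' x'] /= [y't _ ->]].
  by rewrite /revlex_lt /= (allP yt).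
rewrite pairwise_map; apply: sub_pairwise ss => x x' /= xx'.
by rewrite /revlex_lt /= xx' eqxx orbT.
Qed.

(** * Exponents of variables in word monomials *)

(** Meant for [g] the exponent of one variable: equalities of monomials become linear equations in
    the exponents [c]. *)
Lemma word_monomial_morph (W : conomType) (A : alphabet W) (g : W -> nat) :
  g mone = 0 -> {morph g : u v / mmul u v >-> u + v} ->
  forall (l : seq A) (c : seq nat),
  g (word_monomial l c) = \sum_(q <- zip l c) g (letter_val q.1) * q.2.
Proof.
move=> g1 gM l c; rewrite /word_monomial (big_morph g gM g1).
apply: eq_bigr => -[x n] _ /=.
elim: n => [|n IH]; first by rewrite [mexp _ _]/(mone) g1 muln0.
by rewrite mexpS gM IH mulnS.
Qed.

Lemma expX_word (l : seq alphXYXY) (c : seq nat) v :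
  ((word_monomial l c).1 : {cmonom nat}) v =
  \sum_(q <- zip l c) ((val q.1).1 == Some v) * q.2.
Proof.
rewrite (@word_monomial_morph _ _ (fun w : xymonom => (w.1 : {cmonom nat}) v)).
- apply: eq_bigr => -[[[x y] /= xy] n] _ /=; congr (_ * _).
  by case: x y {xy} => [i|] [j|]; rewrite /= !(cmM, cm1, cmU) ?addn0.
- by rewrite cm1.
- by move=> w w'; rewrite cmM.
Qed.

Lemma expY_word (l : seq alphXYXY) (c : seq nat) v :
  ((word_monomial l c).2 : {cmonom nat}) v =
  \sum_(q <- zip l c) ((val q.1).2 == Some v) * q.2.
Proof.
rewrite (@word_monomial_morph _ _ (fun w : xymonom => (w.2 : {cmonom nat}) v)).
- apply: eq_bigr => -[[[x y] /= xy] n] _ /=; congr (_ * _).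
  by case: x y {xy} => [i|] [j|]; rewrite /= !(cmM, cm1, cmU) ?addn0.
- by rewrite cm1.
- by move=> w w'; rewrite cmM.
Qed.

Lemma exp_word (z : seq alphX) (a : seq nat) v :
  (word_monomial z a : {cmonom nat}) v = \sum_(q <- zip z a) (q.1 == v) * q.2.
Proof.
rewrite (@word_monomial_morph _ _ (fun w : xmonom => (w : {cmonom nat}) v)).
- by apply: eq_bigr => q _; rewrite /= cmU.
- by rewrite cm1.
- by move=> w w'; rewrite cmM.
Qed.

(* None is the unit letter x_0 of 1 + X. *)
Definition unit_letters (z : seq nat) : seq (option nat) := None :: map Some z.

Lemma unit_letters_sorted (W : conomType) (h : nat -> W) z : sorted ltn z ->
  sorted (@opt_lt _ (var_alphabet h)) (unit_letters z).
Proof. by case: z => //= x z; rewrite path_map. Qed.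

Lemma size_unit_letters z : size (unit_letters z) = (size z).+1.
Proof. by rewrite /= size_map. Qed.

Lemma unit_letters_uniq z : uniq z -> uniq (unit_letters z).
Proof.
move=> uz; rewrite /= (map_inj_uniq (@Some_inj _)) uz andbT.
by apply/mapP => -[].
Qed.

(** [F] will be the row or column sums of a matrix. [F ord0] stays free: its label [None] is never
    [Some v]. *)
Lemma sum_unit_letters (z : seq alphX) (a : seq nat) v
    (F : 'I_(size a).+1 -> nat) :
  size z = size a -> (forall j, F (lift ord0 j) = nth 0 a j) ->
  \sum_(j : 'I_(size a).+1) (nth None (unit_letters z) j == Some v) * F j =
  (word_monomial z a : {cmonom nat}) v.
Proof.
move=> za Fa; rewrite big_ord_recl add0n exp_word.
rewrite (big_nth (0, 0)) big_mkord size_zip za minnn.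
apply: eq_bigr => j _; rewrite Fa nth_zip //= (nth_map 0) ?add0n ?za //.
Qed.

(** The labels are distinct, and the unit label in front shifts position [j] to [lift ord0 j]. *)
Lemma pick_unit_letter (z : seq nat) m (j : 'I_m) (F : 'I_m.+1 -> nat) :
  uniq z -> size z = m ->
  \sum_(i : 'I_m.+1) (nth None (unit_letters z) i == Some (nth 0 z j)) * F i =
  F (lift ord0 j).
Proof.
move=> uz zm.
have <- : nth None (unit_letters z) (lift ord0 j) = Some (nth 0 z j).
  by rewrite /= (nth_map 0) add0n ?zm.
rewrite (bigD1 (lift ord0 j)) // eqxx mul1n big1 => [|i /andP[_ ij]].
  exact: addn0.
rewrite (nth_uniq None (s := unit_letters z)) ?size_unit_letters ?zm //.
  by rewrite (inj_eq val_inj) (negPf ij).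
exact: unit_letters_uniq.
Qed.

(** * Margins and supports of matrices *)

(* The sums of the first row and column are not prescribed: they are determined
   by the sum of all entries. *)
Definition heis_margins (a b : seq nat)
    (M : 'M[nat]_((size b).+1, (size a).+1)) : Prop :=
  [/\ M ord0 ord0 = 0,
      forall j, \sum_i M i (lift ord0 j) = nth 0 a j &
      forall i, \sum_j M (lift ord0 i) j = nth 0 b i].

(** Once the tail agrees with [s], the truncated subtraction is exact and the equation for the head
    holds automatically. *)
Lemma margin_cons m (F : 'I_m.+1 -> nat) (s : seq nat) :
  size s = m ->
  [seq F j | j <- enum 'I_m.+1] = (\sum_j F j - sumn s) :: s <->
  forall j, F (lift ord0 j) = nth 0 s j.
Proof.
move=> sm; rewrite (map_enum_ordP 0) /= ?sm //; split=> [Fs j|Fs j].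
  by rewrite Fs.
case: (unliftP ord0 j) => [i ->|->]; first by rewrite Fs.
rewrite /= big_ord_recl; under eq_bigr do rewrite Fs.
by rewrite sumnE (big_nth 0) big_mkord sm addnK.
Qed.

Lemma heis_matricesE n (a b : seq nat)
    (M : 'M[nat]_((size b).+1, (size a).+1)) :
  \sum_i \sum_j M i j = n ->
  heis_matrices n a b M <-> heis_margins M.
Proof.
move=> Mn.
have col := margin_cons (fun j => \sum_i M i j) (erefl (size a)).
have row := margin_cons (fun i => \sum_j M i j) (erefl (size b)).
rewrite exchange_big in col; rewrite Mn in row col.
by split=> -[M0 Mc Mr]; split=> //; try (by apply/col); apply/row.
Qed.

Definition cells m n : seq ('I_m * 'I_n) :=
  [seq (i, j) | i <- enum 'I_m, j <- enum 'I_n].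

Lemma mem_cells m n p : p \in cells m n.
Proof. by case: p => i j; apply: allpairs_f; rewrite mem_enum. Qed.

(** Keeps the positions that [nonzero_entries] forgets, in the same order. *)
Definition support m n (M : 'M[nat]_(m, n)) : seq ('I_m * 'I_n) :=
  [seq p <- cells m n | 0 < M p.1 p.2].

Lemma mem_support m n (M : 'M[nat]_(m, n)) p :
  (p \in support M) = (0 < M p.1 p.2).
Proof. by rewrite mem_filter mem_cells andbT. Qed.

Lemma nonzero_entriesE m n (M : 'M[nat]_(m, n)) :
  val (nonzero_entries M) = [seq M p.1 p.2 | p <- support M].
Proof. by rewrite SubK -filter_map map_allpairs. Qed.

Lemma big_support m n (M : 'M[nat]_(m, n)) (F : 'I_m * 'I_n -> nat) :
  \sum_(p <- support M) F p * M p.1 p.2 = \sum_i \sum_j F (i, j) * M i j.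
Proof.
rewrite big_filter big_mkcond /cells big_allpairs_dep big_enum /=.
apply: eq_bigr => i _; rewrite big_enum /=; apply: eq_bigr => j _.
by case: ltnP => //; rewrite leqn0 => /eqP ->; rewrite muln0.
Qed.

Notation unit_alphabet :=
  (mul_alphabet (one_add alphX2) (one_add alphY2)) (only parsing).

(** * Exponents of the letters of a word *)

Section Content.
Context {T : eqType}.
Implicit Types (l : seq T) (d : seq nat).

(* The exponent of x in the product of the powers l_i ^ d_i. *)
Definition content l d (x : T) : nat := \sum_(q <- zip l d | q.1 == x) q.2.

Lemma content_index l d x : uniq l -> size l = size d ->
  content l d x = nth 0 d (index x l).
Proof.
rewrite /content; elim: l d => [|y l IH] [|n d] //=; first by rewrite big_nil.
case/andP=> yl ul [] ld; rewrite big_cons IH //=.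
case: eqVneq => [<-|//] /=; rewrite nth_default ?addn0 //.
by rewrite -ld leqNgt index_mem.
Qed.

Lemma map_content l d : uniq l -> size l = size d ->
  [seq content l d x | x <- l] = d.
Proof.
move=> ul ld; apply: (@eq_from_nth _ 0); rewrite size_map // => i il.
have x0 : T by case: (l) il.
by rewrite (nth_map x0) // content_index // index_uniq.
Qed.

(** The parts of a composition are positive, so positive content detects membership. *)
Lemma content_gt0 l (d : composition) x : uniq l -> size l = size (val d) ->
  (0 < content l (val d) x) = (x \in l).
Proof.
move=> ul ld; rewrite content_index // -index_mem ld.
by case: (ltnP (index x l)) => [dl|dl]; [rewrite comp_nth_gt0|rewrite nth_default].
Qed.

End Content.

(** * From matrices to words *)

Section Bijection.
Context {zx zy : seq alphX} {a b c : composition}.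
Context (zxs : sorted ltn zx) (zys : sorted ltn zy).
Context (zxa : size zx = size (val a)) (zyb : size zy = size (val b)).

Let r := size (val a).
Let s := size (val b).

Definition cell_letter (p : 'I_s.+1 * 'I_r.+1) : unit_alphabet :=
  (nth None (unit_letters zx) p.2, nth None (unit_letters zy) p.1).

Lemma cell_letter_inj : injective cell_letter.
Proof.
case=> i j [i' j'] [/eqP ejj /eqP eii].
move: ejj eii; rewrite !nth_uniq ?unit_letters_uniq ?size_unit_letters ?zxa ?zyb //;
  try exact: sorted_ltn_uniq.
by move=> /eqP /val_inj -> /eqP /val_inj ->.
Qed.

Lemma cell_letterP (x : unit_alphabet) :
  x.1 \in unit_letters zx -> x.2 \in unit_letters zy ->
  exists p, cell_letter p = x.
Proof.
case: x => x y /= /(nthP None)[j jx <-] /(nthP None)[i iy <-].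
rewrite size_unit_letters zxa in jx; rewrite size_unit_letters zyb in iy.
by exists (Ordinal iy, Ordinal jx).
Qed.

Lemma support_letters_sorted (M : 'M[nat]_(s.+1, r.+1)) :
  sorted (@letter_lt _ unit_alphabet) [seq cell_letter p | p <- support M].
Proof.
apply: (subseq_sorted (@letter_trans _ unit_alphabet)).
  exact: map_subseq (filter_subseq _ _).
(* The support is a subsequence of the cells, so the full grid suffices. *)
suff -> : [seq cell_letter p | p <- cells s.+1 r.+1] =
          [seq (x, y) | y <- unit_letters zy, x <- unit_letters zx].
  by apply: allpairs_revlex_sorted; exact: unit_letters_sorted.
rewrite map_allpairs.
rewrite -[in RHS](@map_nth_enum_ord _ None (unit_letters zy) s.+1) ?size_unit_letters ?zyb //.
rewrite -[in RHS](@map_nth_enum_ord _ None (unit_letters zx) r.+1) ?size_unit_letters ?zxa //.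
by rewrite allpairs_mapl allpairs_mapr.
Qed.

(* The default letter of insubd only occurs when M ord0 ord0 != 0. *)
Definition mx_word (M : 'M[nat]_(s.+1, r.+1)) : seq alphXYXY :=
  [seq insubd (Sub (Some 0, None) isT) (cell_letter p) | p <- support M].

(** By injectivity only the corner cell carries the removed letter [(None, None)], and that cell
    lies outside the support. *)
Lemma val_mx_word (M : 'M[nat]_(s.+1, r.+1)) :
  M ord0 ord0 = 0 ->
  [seq val x | x <- mx_word M] = [seq cell_letter p | p <- support M].
Proof.
move=> M0; rewrite -map_comp; apply/eq_in_map => -[i j].
rewrite mem_support /= val_insubd => Mij.
case: eqP => //= /(@cell_letter_inj (i, j) (ord0, ord0)) [ei ej].
by rewrite ei ej M0 in Mij.
Qed.

(** The total is left out: [nonzero_entries M = c] fixes it at [sumn (val c)]. *)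
Definition coef_matrices : set 'M[nat]_(s.+1, r.+1) :=
  [set M | heis_margins M /\ nonzero_entries M = c].

Definition coef_words : set (seq alphXYXY) :=
  [set l | (sorted (@letter_lt _ alphXYXY) l /\ size l = size (val c)) /\
    word_monomial l (val c) =
      (word_monomial zx (val a), word_monomial zy (val b))].

Lemma word_pair_sum (l : seq alphXYXY) (P : unit_alphabet -> nat) :
  \sum_(q <- zip l (val c)) P (val q.1) * q.2 =
  \sum_(q <- zip [seq val x | x <- l] (val c)) P q.1 * q.2.
Proof.
elim: l (val c) => [|x l IH] [|n d]; rewrite ?big_nil // !big_cons IH //.
Qed.

Lemma mx_word_coef M : coef_matrices M -> coef_words (mx_word M).
Proof.
case=> -[M0 Mc Mr] Me; split; first split.
- rewrite -(sorted_map (f := val) (e' := @letter_lt _ unit_alphabet)).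
  by rewrite val_mx_word //; apply: support_letters_sorted.
- by rewrite -Me nonzero_entriesE !size_map.
(* With [P] testing one coordinate of a letter, the left side is the exponent of a variable and the
   right side a sum of column or row sums. *)
have E P : \sum_(q <- zip (mx_word M) (val c)) P (val q.1) * q.2 =
           \sum_i \sum_j P (cell_letter (i, j)) * M i j.
  rewrite word_pair_sum val_mx_word // -Me nonzero_entriesE zip_map big_map.
  exact: (big_support M (P \o cell_letter)).
rewrite [LHS]surjective_pairing; congr pair; apply/eqP/cmP => v.
  rewrite expX_word (E (fun x => x.1 == Some v)) exchange_big /=.
  under eq_bigr do rewrite -big_distrr /=.
  exact: sum_unit_letters.
rewrite expY_word (E (fun x => x.2 == Some v)) /=.
under eq_bigr do rewrite -big_distrr /=.
exact: sum_unit_letters.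
Qed.

(** The word determines the support, [c] lists the entries on it, and all other entries are 0. *)
Lemma mx_word_inj : {in coef_matrices &, injective mx_word}.
Proof.
move=> M M'; rewrite !inE => -[[M0 _ _] Me] [[M0' _ _] Me'].
move=> /(congr1 (map val)); rewrite !val_mx_word // => /(inj_map cell_letter_inj) sM.
have := congr1 val Me; rewrite -Me' !nonzero_entriesE -sM => /eq_in_map MM.
apply/matrixP => i j; have := MM (i, j); rewrite mem_support /=.
case: (posnP (M i j)) => [Mij _|_ -> //].
by have := mem_support M' (i, j); rewrite -sM mem_support /= Mij; lia.
Qed.

Lemma coef_matrix_sum M : coef_matrices M -> \sum_i \sum_j M i j = sumn (val c).
Proof. by case=> _ <-; rewrite sumn_nonzero_entries. Qed.

(** * From words to matrices *)

Definition word_mx (l : seq alphXYXY) : 'M[nat]_(s.+1, r.+1) :=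
  \matrix_(i, j) content [seq val x | x <- l] (val c) (cell_letter (i, j)).

Section WordToMatrix.
Context {l : seq alphXYXY}.
Context (lP : coef_words l).

Let letters : seq unit_alphabet := [seq val x | x <- l].

Lemma letters_sorted : sorted (@letter_lt _ unit_alphabet) letters.
Proof. by case: lP => -[ls _] _; rewrite sorted_map. Qed.

Lemma letters_uniq : uniq letters.
Proof.
by apply: sorted_uniq letters_sorted; [exact: letter_trans|exact: letter_irr].
Qed.

Lemma size_letters : size letters = size (val c).
Proof. by case: lP => -[_ lc] _; rewrite size_map. Qed.

Lemma letters_expX v : \sum_(q <- zip letters (val c)) (q.1.1 == Some v) * q.2 =
  (word_monomial zx (val a) : {cmonom nat}) v.
Proof.
case: lP => _ /(congr1 fst) /= <-.
by rewrite expX_word (word_pair_sum l (fun x => x.1 == Some v)).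
Qed.

Lemma letters_expY v : \sum_(q <- zip letters (val c)) (q.1.2 == Some v) * q.2 =
  (word_monomial zy (val b) : {cmonom nat}) v.
Proof.
case: lP => _ /(congr1 snd) /= <-.
by rewrite expY_word (word_pair_sum l (fun x => x.2 == Some v)).
Qed.

(** A letter of [l] is raised to a positive power, so each variable in it divides the monomial of
    [l] and must occur in [zx] or [zy]. *)
Lemma letters_cell x : x \in letters ->
  (x.1 \in unit_letters zx) && (x.2 \in unit_letters zy).
Proof.
move=> xl; have ic : index x letters < size (val c) by rewrite -size_letters index_mem.
pose n := nth 0 (val c) (index x letters).
have n0 : 0 < n by exact: comp_nth_gt0.
have qin : (x, n) \in zip letters (val c).
  rewrite -[x](nth_index x xl) /n -nth_zip ?size_letters //.
  by apply: mem_nth; rewrite size_zip size_letters minnn.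
have pos (P : pred unit_alphabet) :
    P x -> 0 < \sum_(q <- zip letters (val c)) P q.1 * q.2.
  by move=> Px; rewrite (big_rem (x, n)) //= Px mul1n ltn_addr.
apply/andP; split.
  case ex: x.1 => [v|]; rewrite inE //=; apply: map_f.
  have := pos (fun x => x.1 == Some v); rewrite letters_expX ex eqxx => /(_ isT).
  rewrite word_monomialE ?sorted_ltn_uniq // -index_mem zxa.
  by case: (ltnP (index v _)) => // h; rewrite nth_default.
case ex: x.2 => [v|]; rewrite inE //=; apply: map_f.
have := pos (fun x => x.2 == Some v); rewrite letters_expY ex eqxx => /(_ isT).
rewrite word_monomialE ?sorted_ltn_uniq // -index_mem zyb.
by case: (ltnP (index v _)) => // h; rewrite nth_default.
Qed.

(** Both lists are strictly increasing, so it is enough that they have the same members. *)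
Lemma word_mx_cells : [seq cell_letter p | p <- support (word_mx l)] = letters.
Proof.
apply: (irr_sorted_eq (@letter_trans _ unit_alphabet) (@letter_irr _ unit_alphabet)).
- exact: support_letters_sorted.
- exact: letters_sorted.
move=> x; apply/mapP/idP => [[[i j]]|xl].
  by rewrite mem_support /= mxE content_gt0 ?letters_uniq ?size_letters // => h ->.
have /andP[xx xy] := letters_cell xl; have [[i j] pE] := cell_letterP xx xy.
exists (i, j) => //; rewrite mem_support /= mxE content_gt0 ?letters_uniq ?size_letters //.
by rewrite pE.
Qed.

Lemma word_mx_entries : nonzero_entries (word_mx l) = c.
Proof.
apply: val_inj; rewrite nonzero_entriesE.
rewrite -[RHS](map_content letters_uniq size_letters) -word_mx_cells -map_comp.
by apply/eq_map => -[i j]; rewrite /= mxE word_mx_cells.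
Qed.

Lemma word_mx_corner : word_mx l ord0 ord0 = 0.
Proof.
apply/eqP; rewrite mxE -leqn0 leqNgt content_gt0 ?letters_uniq ?size_letters //.
by apply/mapP => -[[x /= xn] _ xE]; rewrite -xE in xn.
Qed.

Lemma word_mx_sum (P : unit_alphabet -> nat) :
  \sum_i \sum_j P (cell_letter (i, j)) * word_mx l i j =
  \sum_(q <- zip letters (val c)) P q.1 * q.2.
Proof.
rewrite -(big_support _ (P \o cell_letter)).
rewrite -word_mx_cells -[X in zip _ (val X)]word_mx_entries.
by rewrite nonzero_entriesE zip_map big_map.
Qed.

(** A part of [a] is the exponent of its letter of [zx] in the monomial of [l], hence the sum of the
    entries in the column with that label; likewise for [b] and rows. *)
Lemma word_mx_margins : heis_margins (word_mx l).
Proof.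
split=> [|j|i]; first exact: word_mx_corner.
- rewrite -(index_uniq 0 (_ : j < size zx) (sorted_ltn_uniq zxs)) ?zxa //.
  rewrite -word_monomialE ?sorted_ltn_uniq // -letters_expX.
  rewrite -(word_mx_sum (fun x => x.1 == _)) /=; apply: eq_bigr => i _.
  by rewrite pick_unit_letter ?sorted_ltn_uniq.
rewrite -(index_uniq 0 (_ : i < size zy) (sorted_ltn_uniq zys)) ?zyb //.
rewrite -word_monomialE ?sorted_ltn_uniq // -letters_expY.
rewrite -(word_mx_sum (fun x => x.2 == _)) /= exchange_big /=.
by apply: eq_bigr => j _; rewrite pick_unit_letter ?sorted_ltn_uniq.
Qed.

Lemma word_mxK : mx_word (word_mx l) = l.
Proof.
by apply: (inj_map val_inj); rewrite val_mx_word ?word_mx_corner ?word_mx_cells.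
Qed.

End WordToMatrix.

Lemma mx_word_bij : set_bij coef_matrices coef_words mx_word.
Proof.
split; [exact: mx_word_coef|exact: mx_word_inj|move=> l lP].
by exists (word_mx l); [split; [exact: word_mx_margins|exact: word_mx_entries]|
  exact: word_mxK].
Qed.

End Bijection.

Local Open Scope ring_scope.

(** * Coefficients of the product and of the evaluated functions *)

Section Coefficients.
Context {k : fieldType}.

Lemma heis_coord_coeff (a b c : composition) :
  (@heis_coord k a b)@_c =
  \sum_(M \in @coef_matrices a b c) (1 : k).
Proof.
have HE M : nonzero_entries M = c ->
    heis_matrices (sumn (val c)) (val a) (val b) M <-> heis_margins M.
  by move=> <-; apply: heis_matricesE; rewrite sumn_nonzero_entries.
pose F n : k := \sum_(M <- fset_set (heis_matrices n (val a) (val b)))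
   (<< nonzero_entries M >> : {malg k[composition]})@_c.
have -> : (heis_coord a b)@_c =
    \sum_(maxn (sumn (val a)) (sumn (val b)) <= n <
          (sumn (val a) + sumn (val b)).+1) F n.
  by rewrite /heis_coord raddf_sum; apply: eq_bigr => n _; rewrite raddf_sum.
have Fc : F (sumn (val c)) = \sum_(M \in @coef_matrices a b c) (1 : k).
  rewrite /F -fsbig_finite; last exact: finite_heis_matrices.
  rewrite -(@fsbig_widen _ _ _ _ (@coef_matrices a b c)).
  - by apply: eq_fsbigr => M; rewrite inE => -[_ ->]; rewrite mcoeffUU.
  - by move=> M [Mm Mc]; apply/HE.
  move=> M [/= MH Mn]; rewrite mcoeffU; case: eqP => // Mc.
  by case: Mn; split=> //; apply/HE.
(* Matrices of total [n] yield compositions of [n] only. *)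
have F0 n : (sumn (val a) <= n)%N -> n != sumn (val c) -> F n = 0.
  move=> an nc; rewrite /F big_seq big1 // => M.
  rewrite in_fset_set ?inE; last exact: finite_heis_matrices.
  move=> /heis_matrices_size Mn; rewrite mcoeffU; case: eqP => // Mc.
  by rewrite -Mc Mn // eqxx in nc.
have [cab|cab] := boolP (sumn (val c) \in index_iota
    (maxn (sumn (val a)) (sumn (val b))) (sumn (val a) + sumn (val b)).+1).
  rewrite (bigD1_seq (sumn (val c))) ?iota_uniq //= Fc.
  rewrite [X in _ + X]big_seq_cond [X in _ + X]big1 ?addr0 // => n.
  rewrite mem_index_iota geq_max => /andP[/andP[/andP[an _] _] nc].
  exact: F0.
rewrite big_seq big1 => [|n nab]; last first.
  apply: F0; last by apply: contraNneq cab => <-.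
  by move: nab; rewrite mem_index_iota geq_max => /andP[/andP[]].
(* Here [sumn (val c)] is outside the range of [n], whereas the margins force the total of a matrix
   into that range. *)
rewrite (_ : coef_matrices = set0) ?fsbig_set0 //.
apply/seteqP; split=> // M Mg; case/negP: cab; have MS := coef_matrix_sum Mg.
case: Mg => -[M0 Mc Mr] Me.
have Sa : (\sum_i \sum_j M i j = \sum_i M i ord0 + sumn (val a))%N.
  rewrite exchange_big big_ord_recl; congr (_ + _)%N.
  by rewrite sumnE (big_nth 0%N) big_mkord; apply: eq_bigr => ? _; rewrite Mc.
have Sb : (\sum_i \sum_j M i j = \sum_j M ord0 j + sumn (val b))%N.
  rewrite big_ord_recl; congr (_ + _)%N.
  by rewrite sumnE (big_nth 0%N) big_mkord; apply: eq_bigr => ? _; rewrite Mr.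
(* For the upper bound: the corner is 0, and every other entry of the first column is at most the
   sum of its row, a part of [b]. *)
have S0 : (\sum_i M i ord0 <= sumn (val b))%N.
  rewrite big_ord_recl M0 add0n sumnE (big_nth 0%N) big_mkord.
  by apply: leq_sum => i _; rewrite -Mr (bigD1 ord0) //= leq_addr.
by rewrite mem_index_iota geq_max; lia.
Qed.

Lemma Mqsym_XYXY (zx zy : seq alphX) (a b c : composition) :
  sorted ltn zx -> sorted ltn zy ->
  size zx = size (val a) -> size zy = size (val b) ->
  Mqsym alphXYXY c (word_monomial zx (val a), word_monomial zy (val b)) =
  (heis_coord a b)@_c :> k.
Proof.
move=> zxs zys zxa zyb; rewrite heis_coord_coeff /Mqsym.
rewrite -(@fsbig_widen _ _ _ _ (@coef_words zx zy a b c)).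
- rewrite (reindex_fsbig _ _ _ _ (mx_word_bij zxs zys zxa zyb)).
  apply: eq_fsbigr => M; rewrite inE => /(mx_word_coef zxs zys zxa zyb)[_ ->].
  by rewrite eqxx.
- by move=> l [].
by move=> l [/= ls ln]; case: eqP => // lw; case: ln.
Qed.

(** For [F = Mqsym2 p] both sides are 1 if [p = (a, b)] and 0 otherwise, whatever the increasing
    words; linearity does the rest. *)
Lemma pairing2_word (F : @series k xymonom) (zx zy : seq alphX)
    (a b : composition) :
  QSym2 F -> sorted ltn zx -> sorted ltn zy ->
  size zx = size (val a) -> size zy = size (val b) ->
  pairing2 F (Xdes a) (Xdes b) =
  F (word_monomial zx (val a), word_monomial zy (val b)).
Proof.
case=> C _ <- zxs zys zxa zyb; rewrite /pairing2 coordK; last exact: Mqsym2_indep.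
rewrite lcomb_fct; apply: eq_bigr => p _.
by rewrite !pairingMX /Mqsym2 /tensor !Mqsym_word.
Qed.

End Coefficients.

Theorem theorem12p1 (k : fieldType) (char0 : [pchar k]%R =i pred0)
    (f : @series k xmonom) (hf : QSym f) :
  heis_coprod f = qsym_eval alphXYXY f.
Proof.
have [F2 Fpair] := heis_coprodP hf.
apply/funext => -[w1 w2].
have [zx [a [zxs zxa ->]]] := ex_word w1.
have [zy [b [zys zyb ->]]] := ex_word w2.
(* The coefficient at this monomial is a pairing with [Xdes a] and [Xdes b], which the adjunction
   moves to the product. *)
rewrite -(pairing2_word F2 zxs zys zxa zyb) Fpair; try exact: spanU.
rewrite heis_prodXX heis_prodXE.
(* Expanding [f] in the basis [Mqsym alphX] leaves an identity for each basis element. *)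
move: hf; rewrite QSym_span => -[c _ <-].
rewrite pairing_lcomb /qsym_eval coordK; last exact: Mqsym_indep.
by rewrite lcomb_fct; apply: eq_bigr => d _; rewrite Mqsym_XYXY.
Qed.
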